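(* Let $N\ge1$ and $t\in\mathbb{R}^N$, let $e_t(x)=\exp(-i\langle t,x\rangle)$ for $x\in\mathbb{R}^N$, and let $f_{e_t}:\mathbb{R}^N\to\mathbb{C}$ be the solution to the Stein equation with test function $h=e_t$ given by $$f_{e_t}(x)=\int_0^1\frac{1}{2s}\,\mathbb{E}\left[e_t(\Xi)-e_t\left(\sqrt{s}\,x+\sqrt{1-s}\,\Xi\right)\right]ds,$$ where $\Xi$ is a standard normally distributed random $N$-vector. Then for all $x\in\mathbb{R}^N$, $$\mathrm{Hess}f_{e_t}(x)=\frac12\,tt^\tau\int_0^1\exp\left(-i\sqrt{s}\,\langle t,x\rangle-\tfrac12(1-s)|t|^2\right)ds.$$ In particular, for all $x,y\in\mathbb{R}^N$, $$\mathrm{Hess}f_{e_t}(x)-\mathrm{Hess}f_{e_t}(y)=\frac12\,tt^\tau\int_0^1 e_{\sqrt{s}t}(y)\left[e_{\sqrt{s}t}(x-y)-1\right]\exp\left(-\tfrac12(1-s)|t|^2\right)ds.$$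
   Context: $|\cdot|$ and $\langle\cdot,\cdot\rangle$ are the Euclidean norm and inner product on $\mathbb{R}^N$. Vectors are regarded as column vectors and $\tau$ denotes transpose, so $tt^\tau$ is an $N\times N$ matrix. $\mathrm{Hess}f(x)$ is the Hessian matrix of $f$ at $x$. For bounded, twice continuously differentiable $h:\mathbb{R}^N\to\mathbb{C}$ with bounded first and second order partial derivatives, the Stein equation with test function $h$ is $\langle x,\nabla f(x)\rangle-\Delta f(x)=\mathbb{E}[h(\Xi)]-h(x)$, where $\langle x,\nabla f(x)\rangle=\sum_{l=1}^N x_l\,\partial f/\partial x_l(x)$. *)

(* Defs.v *)
From HB Require Import structures.
From mathcomp Require Import all_boot all_order all_algebra.
From mathcomp Require Import complex.
From mathcomp Require Import all_classical all_reals all_analysis.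

Set Implicit Arguments.
Unset Strict Implicit.
Unset Printing Implicit Defensive.

Import Order.TTheory GRing.Theory Num.Theory.
Import numFieldNormedType.Exports.

Local Open Scope classical_set_scope.
Local Open Scope ring_scope.
Local Open Scope complex_scope.

(* Euclidean inner product; |t|^2 is written dotp t t, because the library norm
   on matrices is the sup norm. *)
Definition dotp (R : realType) (N : nat) (u v : 'cV[R]_N) : R :=
  \sum_(k < N) u k ord0 * v k ord0.

Definition cexp (R : realType) (z : R[i]) : R[i] :=
  (expR (complex.Re z))%:C * (cos (complex.Im z) +i* sin (complex.Im z)).

Definition e_ (R : realType) (N : nat) (t x : 'cV[R]_N) : R[i] :=
  cexp (- ('i%C * (dotp t x)%:C)).

Definition integral01 (R : realType) (F : R -> R[i]) : R[i] :=
  Rintegral lebesgue_measure `[0, 1] (fun s => complex.Re (F s)) +i*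
  Rintegral lebesgue_measure `[0, 1] (fun s => complex.Im (F s)).

Definition cexpectation (d : measure_display) (T : measurableType d)
    (R : realType) (P : probability T R) (X : T -> R[i]) : R[i] :=
  fine ('E_P[fun w => complex.Re (X w)])%E +i* fine ('E_P[fun w => complex.Im (X w)])%E.

(* The law of Xi is the N-fold product of N(0, 1), tested on measurable
   rectangles: the components are independent standard normal variables. *)
Definition standard_normal_vector (d : measure_display) (T : measurableType d)
    (R : realType) (P : probability T R) (N : nat) (Xi : T -> 'cV[R]_N) : Prop :=
  (forall k : 'I_N, measurable_fun setT (fun w => Xi w k ord0)) /\
  (forall B : 'I_N -> set R, (forall k, measurable (B k)) ->
     P [set w | forall k, B k (Xi w k ord0)] =
     (\prod_(k < N) normal_prob 0 1 (B k))%E).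

(* At s = 0 the integrand is 0 by the convention 0^-1 = 0; this does not affect
   the Lebesgue integral. *)
Definition stein_solution (d : measure_display) (T : measurableType d)
    (R : realType) (P : probability T R) (N : nat) (Xi : T -> 'cV[R]_N)
    (h : 'cV[R]_N -> R[i]) (x : 'cV[R]_N) : R[i] :=
  integral01 (fun s => (1 / (2 * s))%:C *
    cexpectation P (fun w =>
      h (Xi w) - h (Num.sqrt s *: x + Num.sqrt (1 - s) *: Xi w))).

Definition partial (R : realType) (N : nat) (k : 'I_N)
    (f : 'cV[R]_N -> R[i]) (x : 'cV[R]_N) : R[i] :=
  'D_(delta_mx k ord0) (fun z => complex.Re (f z)) x +i*
  'D_(delta_mx k ord0) (fun z => complex.Im (f z)) x.

Definition cdifferentiable (R : realType) (N : nat)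
    (f : 'cV[R]_N -> R[i]) (x : 'cV[R]_N) : Prop :=
  differentiable (fun z => complex.Re (f z)) x /\ differentiable (fun z => complex.Im (f z)) x.

(* 'D_v is total in the library, so the existence of the second order partial
   derivatives is a separate property. *)
Definition twice_differentiable (R : realType) (N : nat)
    (f : 'cV[R]_N -> R[i]) : Prop :=
  forall x, cdifferentiable f x /\ forall k, cdifferentiable (partial k f) x.

Definition Hess (R : realType) (N : nat) (f : 'cV[R]_N -> R[i])
    (x : 'cV[R]_N) : 'M[R[i]]_N :=
  \matrix_(k < N, l < N) partial k (partial l f) x.

Definition outer (R : realType) (N : nat) (t : 'cV[R]_N) : 'M[R[i]]_N :=
  map_mx (fun r : R => r%:C) (t *m t^T).

(* Main.v *)
Require Import Defs.
From mathcomp Require Import all_boot all_order all_algebra.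
From mathcomp Require Import ring lra.
From mathcomp Require Import complex.
From mathcomp Require Import all_classical all_reals all_analysis.
From mathcomp Require Import measurable_realfun.

Set Implicit Arguments.
Unset Strict Implicit.
Unset Printing Implicit Defensive.

Import Order.TTheory GRing.Theory Num.Theory.
Import numFieldNormedType.Exports.
Import HBNNSimple.

Local Open Scope classical_set_scope.
Local Open Scope ring_scope.
Local Open Scope complex_scope.

(* The integrand depends on x only through u = <t, x>. Writing cos (v + pi / 2)
   for - sin v, the real and the imaginary part of f_{e_t} are the cases th = 0
   and th = pi / 2 of
     g_th(u) = int_0^1 1/(2s) (exp(-|t|^2/2) cos th
                - exp(-(1-s)|t|^2/2) cos(sqrt(s) u + th)) ds,
   by the formula E[cos(th + <t, Xi>)] = cos th exp(-|t|^2/2). That formula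
   follows, one coordinate at a time, from the one-dimensional case
   Phi(l) = E[cos(l Z + th)], which solves Phi' = - l Phi by Stein's identity.
   Finally g_th is differentiated twice under the integral sign: the integrand
   is O(s^(-1/2)), and so is its first derivative uniformly in u, while the
   second derivative is bounded. *)

(** * Gaussian integrals in dimension one *)

(** Global form of differentiation under the integral sign: [G] dominates the derivative for every
    parameter, so the local theorem applies on the interval of radius 1 around [a], with [|G|] as
    nonnegative majorant. *)
Lemma is_derive_Rintegral d (Y : measurableType d) (R : realType)
    (mu : {measure set Y -> \bar R}) (B : set Y) (f df : R -> Y -> R)
    (G : Y -> R) (a : R) :
  measurable B ->
  (forall x, mu.-integrable B (EFin \o f x)) ->
  (forall (x : R) y, B y -> is_derive x 1 (f ^~ y) (df x y)) ->
  mu.-integrable B (EFin \o G) ->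
  (forall x y, B y -> `|df x y| <= G y) ->
  is_derive a 1 (fun x => \int[mu]_(y in B) f x y)
    (\int[mu]_(y in B) df a y).
Proof.
move=> mB intf derf intG dfG.
have dE x y : B y -> partial1of2 f x y = df x y.
  by move=> By; rewrite partial1of2E; have [] := derf x y By.
have aI : `]a - 1, a + 1[%classic a by rewrite /= in_itv /=; apply/andP; split; lra.
have G0 y : 0 <= `|G y| by [].
have intG' : mu.-integrable B (EFin \o (fun y => `|G y|)).
  exact: integrable_norm.
have G_ub x y : `]a - 1, a + 1[%classic x -> B y ->
    `|partial1of2 f x y| <= `|G y|.
  by move=> _ By; rewrite dE// (le_trans (dfG x y By))// ler_norm.
have df1 x y : `]a - 1, a + 1[%classic x -> B y -> derivable (f ^~ y) x 1.
  by move=> _ By; have := derf x y By => -[].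
have intf' x : `]a - 1, a + 1[%classic x -> mu.-integrable B (EFin \o f x).
  by move=> _; exact: intf.
apply: DeriveDef.
  exact: (derivable_under_integral mB aI intf' df1 G0 intG' G_ub).
rewrite -derive1E.
rewrite (differentiation_under_integral mB aI intf' df1 G0 intG' G_ub).
by apply: eq_Rintegral => y /set_mem By; rewrite -dE.
Qed.

Lemma is_derive_cos_affine (R : realType) (x th u : R) :
  is_derive u 1 (fun u => cos (u * x + th)) (- x * sin (u * x + th)).
Proof.
have h : is_derive u (1 : R) (fun u => u * x + th) x.
  by apply: is_derive_eq; rewrite scaler0 add0r addr0 /GRing.scale /= mulr1.
have := @is_derive1_comp R cos (fun u => u * x + th) u _ _ (is_derive_cos _) h.
by rewrite mulrC mulrN -mulNr.
Qed.

Lemma is_derive_sin_affine (R : realType) (x th u : R) :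
  is_derive u 1 (fun u => sin (u * x + th)) (x * cos (u * x + th)).
Proof.
have h : is_derive u (1 : R) (fun u => u * x + th) x.
  by apply: is_derive_eq; rewrite scaler0 add0r addr0 /GRing.scale /= mulr1.
have := @is_derive1_comp R sin (fun u => u * x + th) u _ _ (is_derive_sin _) h.
by rewrite mulrC.
Qed.

Lemma measurable_comp_affine (R : realType) (f : R -> R) (a b : R) :
  continuous f -> measurable_fun setT (fun x => f (a * x + b)).
Proof.
move=> cf; apply: measurableT_comp; first exact: continuous_measurable_fun.
by apply: measurable_funD => //; apply: measurable_funM.
Qed.

Lemma integrable_bounded_mul d (Y : measurableType d) (R : realType)
    (mu : {measure set Y -> \bar R}) (B : set Y) (h p : Y -> R) (c : R) :
  measurable B -> measurable_fun B h -> (forall y, `|h y| <= c) ->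
  mu.-integrable B (EFin \o p) ->
  mu.-integrable B (fun y => (h y * p y)%:E).
Proof.
move=> mB mh hc ip.
have mp : measurable_fun B p by case/integrableP: ip => /measurable_EFinP.
apply: (le_integrable mB (f := fun y => (h y * p y)%:E) (g := fun y => c%:E * (p y)%:E)%E).
- by apply/measurable_EFinP; exact: measurable_funM.
- move=> y _; rewrite -EFinM /= lee_fin normrM (normrM c) ler_wpM2r//.
  by rewrite (le_trans (hc y))// ler_norm.
- exact: integrableZl.
Qed.

Section gaussian_char.
Variable R : realType.
Local Notation mu := (@lebesgue_measure R).
Local Notation p := (normal_pdf (0 : R) 1).

Lemma normal_pdf01E (x : R) : p x = normal_peak 1 * expR (- x ^+ 2 / 2).
Proof. by rewrite normal_pdfE// /normal_fun subr0 expr1n. Qed.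

Lemma is_derive_normal_pdf01 (x : R) : is_derive x 1 p (- x * p x).
Proof.
have -> : p = (fun x => normal_peak 1 * expR (- x ^+ 2 / 2)).
  by apply/funext => y; rewrite normal_pdf01E.
have h : is_derive x (1 : R) (fun x : R => - x ^+ 2 / 2) (- x).
  apply: is_derive_eq.
  by rewrite /GRing.scale /=; field.
have := @is_derive1_comp R expR (fun x : R => - x ^+ 2 / 2) x _ _ (is_derive_expR _) h.
move=> h2; apply: (@is_derive_eq _ _ _ _ _ _ _ _ (is_deriveZ (normal_peak 1) h2)).
rewrite /GRing.scale /=; ring.
Qed.

(** Half of the Gaussian exponent absorbs the factor [|x|]; the other half still gives an integrable
    majorant and decay at infinity. *)
Lemma abs_mul_normal_pdf01_le (x : R) :
  `|x * p x| <= normal_peak 1 * expR (- x ^+ 2 / 4).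
Proof.
rewrite normrM (ger0_norm (normal_pdf_ge0 _ _ _)) normal_pdf01E mulrCA.
rewrite ler_wpM2l ?normal_peak_ge0//.
have -> : - x ^+ 2 / 2 = - (x ^+ 2 / 4) + - x ^+ 2 / 4 by field.
rewrite expRD mulrA ler_piMl ?expR_ge0// expRN ler_pdivrMr ?expR_gt0// mul1r.
(* |x| <= 1 + x^2 / 4 <= exp (x^2 / 4) *)
rewrite (le_trans _ (expR_ge1Dx _))//.
have := sqr_ge0 (`|x| / 2 - 1); rewrite -(real_normK (num_real x)); nra.
Qed.

(** Up to a constant, this is the density of the centred normal law of variance 2. *)
Lemma integrable_gaussian_quarter :
  mu.-integrable setT (EFin \o (fun x : R => normal_peak 1 * expR (- x ^+ 2 / 4))).
Proof.
have h : Num.sqrt 2 != 0 :> R by rewrite gt_eqF// sqrtr_gt0.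
have := integrable_normal_pdf (0 : R) (Num.sqrt 2).
move=> /(@integrableZl _ _ _ mu setT measurableT (normal_peak 1 * (normal_peak (Num.sqrt 2))^-1)).
apply: eq_integrable => // x _.
rewrite /= normal_pdfE// /normal_fun subr0 sqr_sqrtr// -EFinM; congr EFin.
rewrite mulrA mulfVK ?gt_eqF ?normal_peak_gt0//.
by congr (_ * expR (_ / _)); lra.
Qed.

Lemma integrable_mul_normal_pdf01 (h : R -> R) :
  measurable_fun setT h -> (forall x, `|h x| <= 1) ->
  mu.-integrable setT (fun x => (h x * p x)%:E).
Proof.
move=> mh hb; apply: (@integrable_bounded_mul _ _ _ mu setT h p 1 measurableT mh hb).
exact: integrable_normal_pdf.
Qed.

Lemma integrable_mulx_normal_pdf01 (h : R -> R) :
  measurable_fun setT h -> (forall x, `|h x| <= 1) ->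
  mu.-integrable setT (fun x => (h x * (x * p x))%:E).
Proof.
move=> mh hb; apply: (@integrable_bounded_mul _ _ _ mu setT h (fun x => x * p x) 1 measurableT mh hb).
apply: le_integrable integrable_gaussian_quarter => //.
  by apply/measurable_EFinP/measurable_funM => //; exact: measurable_normal_pdf.
by move=> x _ /=; rewrite lee_fin (le_trans (abs_mul_normal_pdf01_le x))// ler_norm.
Qed.

(** The fundamental theorem of calculus on growing symmetric intervals, followed by dominated
    convergence with majorant [|f|]. *)
Lemma Rintegral_derivative_eq0 (f F : R -> R) :
  continuous f -> (forall x : R, is_derive x 1 F (f x)) ->
  mu.-integrable setT (EFin \o f) ->
  (fun n => F n.+1%:R - F (- n.+1%:R)) @ \oo --> (0 : R) ->
  \int[mu]_x f x = 0.
Proof.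
move=> cf dF intf F0.
(* The successor keeps the interval nondegenerate at [n = 0], as the fundamental theorem
   requires. *)
pose I n := `[(- n.+1%:R : R), n.+1%:R]%classic.
have IE n : \int[mu]_(x in I n) f x = F n.+1%:R - F (- n.+1%:R).
  have n0 : (- n.+1%:R : R) < n.+1%:R by rewrite gtrN// ltr0Sn.
  have cF : continuous F.
    by move=> x; apply/differentiable_continuous/derivable1_diffP; have [] := dF x.
  rewrite /Rintegral (@continuous_FTC2 _ f F _ _ n0) //.
  - exact: continuous_subspaceT.
  - split.
    + by move=> x _; have [] := dF x.
    + by apply: cvg_at_right_filter; exact: cF.
    + by apply: cvg_at_left_filter; exact: cF.
  - by move=> x _; rewrite derive1E; have [] := dF x.
suff : (fun n => \int[mu]_(x in I n) f x) @ \oo --> \int[mu]_x f x.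
  by under eq_fun do rewrite IE; move/cvg_unique => /(_ (@Rhausdorff R) _ F0).
have mI n : measurable (I n) by exact: measurable_itv.
under eq_fun do rewrite Rintegral_mkcond.
rewrite /Rintegral; apply: fine_cvg.
rewrite fineK; last by apply: integrable_fin_num.
have mf : measurable_fun setT f.
  by have /integrableP[/measurable_EFinP] := intf.
apply: (@dominated_cvg _ _ _ mu _ _ (fun n x => ((f \_ (I n)) x)%:E) _
   (EFin \o (fun x => `|f x|))) => //=.
- move=> n; apply/measurable_EFinP.
  by apply/(measurable_restrictT _ (mI n)); apply: measurable_funTS.
- move=> x _; apply: cvg_EFin; first exact: nearW.
  (* For fixed [x] the truncation is eventually inactive, namely once [n >= |x|]. *)
  apply: (@cvg_near_cst _ R^o) => //.
  near=> n; rewrite /= /patch ifT// inE /I /= in_itv /= -ler_norml.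
  rewrite (@le_trans _ _ n%:R)// ?ler_nat//.
  by near: n; exact: nbhs_infty_ger.
- exact: integrable_norm.
- move=> n x _; rewrite lee_fin /patch; case: ifP => // _.
  by rewrite normr0.
Unshelve. all: by end_near. Qed.

(** Since [x * p x] is bounded by the peak, [p] decays at least like [1 / |x|], and the harmonic
    sequence is a majorant. The sign [s] selects the end of the real line. *)
Lemma cvg_bounded_mul_normal_pdf01 (h : R -> R) (s : R) :
  (forall x, `|h x| <= 1) -> s = 1 \/ s = - 1 ->
  (fun n => h (s * n.+1%:R) * p (s * n.+1%:R)) @ \oo --> (0 : R).
Proof.
move=> hb s1; apply: norm_cvg0.
apply: (@squeeze_cvgr _ _ _ _ (cst 0) (fun n => normal_peak 1 * harmonic n)).
- apply: nearW => n /=; rewrite normr_ge0 /= normrM.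
  set x := s * _.
  have nx : `|x| = n.+1%:R.
    by rewrite normrM normr_nat; case: s1 => ->; rewrite ?normrN normr1 mul1r.
  apply: (@le_trans _ _ `|p x|); first by rewrite ler_piMl.
  rewrite /harmonic ler_pdivlMr// -nx -normrM mulrC.
  rewrite (le_trans (abs_mul_normal_pdf01_le _))// ler_piMr ?normal_peak_ge0//.
  by rewrite -expR0 ler_expR mulNr oppr_le0 divr_ge0// sqr_ge0.
- exact: cvg_cst.
- by rewrite -[X in _ --> X](mulr0 (normal_peak 1)); apply: cvgMl_tmp; exact: cvg_harmonic.
Qed.

(** Stein's identity E[Z F(Z)] = E[F'(Z)] for F(x) = sin(l x + th). As p' = - x p, the difference of
    the two integrands is the derivative of F p, which vanishes at both ends. *)
Lemma stein_normal_pdf01 (l th : R) :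
  \int[mu]_x (sin (l * x + th) * (x * p x)) =
  l * \int[mu]_x (cos (l * x + th) * p x).
Proof.
have cp : continuous p by exact: continuous_normal_pdf.
have ca f : continuous f -> continuous (fun x : R => f (l * x + th) : R).
  move=> cf x; apply: continuous_comp; last exact: cf.
  by apply: cvgD; [apply: cvgMl_tmp; exact: cvg_id|exact: cvg_cst].
have is1 := @integrable_mulx_normal_pdf01 (fun x => sin (l * x + th))
  (measurable_comp_affine l th (@continuous_sin R)) (fun x => sin_max _).
have ic := @integrable_mul_normal_pdf01 (fun x => cos (l * x + th))
  (measurable_comp_affine l th (@continuous_cos R)) (fun x => cos_max _).
have icl : mu.-integrable setT (EFin \o (fun x => l * (cos (l * x + th) * p x))).
  by have := integrableZl measurableT l ic; apply: eq_integrable.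
apply/eqP; rewrite eq_sym -subr_eq0 -RintegralZl// -RintegralB//; apply/eqP.
apply: (@Rintegral_derivative_eq0 _ (fun x => sin (l * x + th) * p x)).
- move=> x; apply: cvgB.
  + apply: cvgMl_tmp; apply: cvgM; last exact: cp.
    exact: (ca cos (@continuous_cos _)).
  + apply: cvgM; first exact: (ca sin (@continuous_sin _)).
    by apply: cvgM; [exact: cvg_id|exact: cp].
- move=> x.
  have h1 := is_derive_sin_affine l th x.
  have h2 := is_derive_normal_pdf01 x.
  have h3 : is_derive x 1 (fun x => sin (l * x + th)) (l * cos (l * x + th)).
    by under eq_fun do rewrite mulrC; rewrite [X in cos (X + _)]mulrC.
  apply: (@is_derive_eq _ _ _ _ _ _ _ _ (is_deriveM h3 h2)).
  rewrite /GRing.scale /=; ring.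
- by have := integrableB measurableT icl is1; apply: eq_integrable.
- rewrite -[X in _ --> X](subrr 0); apply: cvgB.
  + have := @cvg_bounded_mul_normal_pdf01 (fun x => sin (l * x + th)) 1
      (fun x => sin_max _) (or_introl erefl).
    by under eq_fun do rewrite mul1r.
  + have := @cvg_bounded_mul_normal_pdf01 (fun x => sin (l * x + th)) (-1)
      (fun x => sin_max _) (or_intror erefl).
    by under eq_fun do rewrite mulN1r.
Qed.

Lemma char_normal_pdf01 (l th : R) :
  \int[mu]_x (cos (l * x + th) * p x) = cos th * expR (- l ^+ 2 / 2).
Proof.
pose Phi l := \int[mu]_x (cos (l * x + th) * p x).
have dPhi (k : R) : is_derive k 1 Phi (- k * Phi k).
  (* Stein's identity turns the derivative taken under the integral into a multiple of [Phi k]. *)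
  have -> : - k * Phi k = \int[mu]_x (- x * sin (k * x + th) * p x).
    rewrite mulNr -stein_normal_pdf01 -mulN1r -RintegralZl//; last first.
      apply: integrable_mulx_normal_pdf01; last by move=> x; exact: sin_max.
      exact: (measurable_comp_affine k th (@continuous_sin R)).
    by apply: eq_Rintegral => x _; ring.
  apply: (@is_derive_Rintegral _ _ _ mu setT (fun k x => cos (k * x + th) * p x)
    (fun k x => - x * sin (k * x + th) * p x)
    (fun x => normal_peak 1 * expR (- x ^+ 2 / 4))) => //.
  - move=> {}k; apply: integrable_mul_normal_pdf01; last by move=> x; exact: cos_max.
    exact: (measurable_comp_affine k th (@continuous_cos R)).
  - move=> {}k x _.
    have h := is_deriveM (is_derive_cos_affine x th k) (is_derive_cst (p x) k 1).
    apply: (@is_derive_eq _ _ _ _ _ _ _ _ h).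
    rewrite /GRing.scale /cst /=; ring.
  - exact: integrable_gaussian_quarter.
  - move=> {}k x _; apply: le_trans (abs_mul_normal_pdf01_le x).
    rewrite [X in X <= _](_ : _ = `|sin (k * x + th)| * `|x * p x|).
      by rewrite ler_piMl// sin_max.
    by rewrite -normrM mulNr mulNr normrN; congr `|_|; ring.
(* Integrating factor for Phi' = - k Phi: [Psi] has derivative 0, so its value at [l] is the one at
   0, where [Phi 0] is [cos th] times the total mass of [p]. *)
pose Psi k := Phi k * expR (k ^+ 2 / 2).
have dPsi (k : R) : is_derive k 1 Psi 0.
  have hq : is_derive k (1 : R) (fun x : R => x ^+ 2 / 2) k.
    by apply: is_derive_eq; rewrite /GRing.scale /=; field.
  have he := @is_derive1_comp R expR (fun x : R => x ^+ 2 / 2) k _ _ (is_derive_expR _) hq.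
  apply: (@is_derive_eq _ _ _ _ _ _ _ _ (is_deriveM (dPhi k) he)).
  rewrite /GRing.scale /=; ring.
have := @is_derive_0_is_cst R Psi l 0 dPsi.
rewrite /Psi expr0n /= mul0r expR0 mulr1 => h.
have -> : \int[mu]_x (cos (l * x + th) * p x) = Psi l * expR (- l ^+ 2 / 2).
  by rewrite /Psi -mulrA -expRD mulNr addrN expR0 mulr1.
rewrite /Psi h; congr (_ * _); rewrite /Phi.
under eq_Rintegral do rewrite mul0r add0r.
rewrite RintegralZl//; last exact: integrable_normal_pdf.
by rewrite /Rintegral integral_normal_pdf mulr1.
Qed.

End gaussian_char.

(** * Integration against a weighted law *)

Section weighted_law.
Context d (T : measurableType d) d' (T' : measurableType d') (R : realType).

(* The weight [w] plays the role of a density: the hypothesis says that the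
   image under [X] of the measure [w dmu] is [c nu]. *)
Lemma ge0_integral_weighted_law (mu : {measure set T -> \bar R})
    (nu : {measure set T' -> \bar R}) (w : T -> R) (X : T -> T') (c : R)
    (g : T' -> R) :
  measurable_fun setT w -> (forall x, 0 <= w x) -> measurable_fun setT X ->
  (forall B, measurable B ->
    (\int[mu]_(x in X @^-1` B) (w x)%:E = c%:E * nu B)%E) ->
  measurable_fun setT g -> (forall y, 0 <= g y) ->
  (\int[mu]_x (w x * g (X x))%:E = c%:E * \int[nu]_y (g y)%:E)%E.
Proof.
move=> mw w0 mX wX mg g0.
have mg' : measurable_fun setT (EFin \o g) by exact/measurable_EFinP.
pose h := nnsfun_approx measurableT mg'.
have hg y : (EFin \o (fun n => h n y)) n @[n --> \oo] --> (EFin \o g) y.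
  by apply: cvg_nnsfun_approx => // z _; rewrite lee_fin.
have hnd y m n : (m <= n)%N -> h m y <= h n y.
  by move=> mn; exact/lefP/nd_nnsfun_approx.
have mXB B : measurable B -> measurable (X @^-1` B).
  by move=> mB; rewrite -[X in measurable X]setTI; exact: mX.
(* For a simple function, linearity reduces the claim to its level sets, where the hypothesis on the
   image measure applies. Both sides then pass to the limit by monotone convergence. *)
have simple n : (\int[mu]_x (w x * h n (X x))%:E = c%:E * \int[nu]_y (h n y)%:E)%E.
  rewrite integralT_nnsfun sintegralE.
  transitivity (\int[mu]_x (\sum_(r \in range (h n))
      (w x * (r * \1_(h n @^-1` [set r]) (X x)))%:E))%E.
    apply: eq_integral => x _.
    by rewrite fsumEFin// -mulr_fsumr// -(fimfunE _ (X x)).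
  rewrite ge0_integral_fsum//=; first last.
  - move=> r x _; rewrite lee_fin mulr_ge0//.
    by have := nnfun_muleindic_ge0 (h n) r (X x); rewrite -EFinM lee_fin.
  - move=> r; apply/measurable_EFinP; apply: measurable_funM => //.
    by apply: measurable_funM => //; apply: measurableT_comp mX.
  rewrite ge0_mule_fsumr; last first.
    by move=> r; exact: nnsfun_mulemu_ge0.
  apply: eq_fsbigr => r /set_mem [y _ hy].
  have r0 : 0 <= r by rewrite -hy.
  have mA : measurable (h n @^-1` [set r]) by [].
  transitivity (\int[mu]_x (r%:E * (((EFin \o w) \_ (X @^-1` (h n @^-1` [set r]))) x)))%E.
    apply: eq_integral => x _; rewrite /patch /= indicE.
    have -> : (X x \in h n @^-1` [set r]) = (x \in X @^-1` (h n @^-1` [set r])).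
      by apply/idP/idP; rewrite !inE.
    by case: ifP => _; rewrite -?EFinM ?mulr1 ?mulr0 ?mule0 // mulrC.
  rewrite ge0_integralZl//; last 2 first.
  - by apply/(measurable_restrictT _ (mXB _ mA)); exact/measurable_funTS/measurable_EFinP.
  - by move=> x _; rewrite /patch; case: ifP => //= _; rewrite lee_fin.
  by rewrite -integral_mkcond wX// muleCA.
have cvg1 : (\int[mu]_x (w x * h n (X x))%:E)%E @[n --> \oo] -->
    (\int[mu]_x (w x * g (X x))%:E)%E.
  rewrite [X in _ --> X](_ : _ = \int[mu]_x (limn (fun n => (w x * h n (X x))%:E)))%E.
    apply: cvg_monotone_convergence => //.
    - move=> n; apply/measurable_EFinP; apply: measurable_funM => //.
      by apply: measurableT_comp mX.
    - by move=> n x _; rewrite lee_fin mulr_ge0.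
    - by move=> x _ m n mn; rewrite lee_fin ler_wpM2l// hnd.
  apply: eq_integral => x _; apply/esym/cvg_lim => //.
  under eq_fun do rewrite EFinM.
  by rewrite EFinM; apply: cvgeZl => //; exact: hg.
have cvg2 : (\int[nu]_y (h n y)%:E)%E @[n --> \oo] --> (\int[nu]_y (g y)%:E)%E.
  rewrite [X in _ --> X](_ : _ = \int[nu]_y (limn (fun n => (h n y)%:E)))%E.
    apply: cvg_monotone_convergence => //.
    - by move=> n; exact/measurable_EFinP.
    - by move=> n x _; rewrite lee_fin.
    - by move=> x _ m n mn; rewrite lee_fin hnd.
  by apply: eq_integral => x _; apply/esym/cvg_lim => //; exact: hg.
have {cvg2} := cvgeZl (isT : c%:E \is a fin_num) cvg2.
under eq_fun do rewrite -simple.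
by move/cvg_unique => /(_ (@ereal_hausdorff R) _ cvg1).
Qed.

Lemma integrable_bounded (P : probability T R) (A : set T) (f : T -> R) (M : R) :
  measurable A -> measurable_fun setT f -> (forall x, `|f x| <= M) ->
  P.-integrable A (EFin \o f).
Proof.
move=> mA mf fM; apply: measurable_bounded_integrable => //.
- by rewrite (le_lt_trans (probability_le1 P mA))// ltry.
- exact: measurable_funTS.
- exists M; split; first exact: num_real.
  by move=> x Mx y _; exact: (le_trans (fM y) (ltW Mx)).
Qed.

End weighted_law.

Section ge0_Rintegral_weighted_law.
Context d (T : measurableType d) d' (T' : measurableType d') (R : realType).

(** A bounded [g] is made nonnegative by adding [K]. The added constant contributes [c * K] on both
    sides, because the total mass of the weight is [c], and cancels. *)
Lemma ge0_Rintegral_weighted_law (mu : {measure set T -> \bar R})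
    (nu : probability T' R) (X : T -> T') (w : T -> R) (c : R) (g : T' -> R)
    (K : R) :
  measurable_fun setT X ->
  mu.-integrable setT (EFin \o w) -> (forall x, 0 <= w x) ->
  (forall B, measurable B ->
    \int[mu]_(x in X @^-1` B) w x = c * fine (nu B)) ->
  measurable_fun setT g -> (forall y, `|g y| <= K) ->
  \int[mu]_x (w x * g (X x)) = c * \int[nu]_y g y.
Proof.
move=> mX iwT w0 wX mg gK.
have mXB B : measurable B -> measurable (X @^-1` B).
  by move=> mB; rewrite -[X in measurable X]setTI; exact: mX.
have mw : measurable_fun setT w.
  by have /integrableP[/measurable_EFinP] := iwT.
have iw A : measurable A -> mu.-integrable A (EFin \o w).
  by move=> mA; exact: (integrableS measurableT).
have ewX B : measurable B -> (\int[mu]_(x in X @^-1` B) (w x)%:E = c%:E * nu B)%E.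
  move=> mB; rewrite -[LHS]fineK; last first.
    by apply: integrable_fin_num => //; [exact: mXB|exact/iw/mXB].
  by rewrite -/(Rintegral _ _ _) wX// EFinM fineK// fin_num_measure.
have wXT : \int[mu]_x w x = c.
  by have := wX setT measurableT; rewrite preimage_setT probability_setT mulr1.
have mgX : measurable_fun setT (g \o X) by exact: measurableT_comp.
have iwg : mu.-integrable setT (EFin \o (fun x => w x * g (X x))).
  have := @integrable_bounded_mul _ _ _ mu setT (g \o X) w K measurableT mgX
    (fun x => gK (X x)) iwT.
  by apply: eq_integrable => // x _; rewrite /= mulrC.
have ig : nu.-integrable setT (EFin \o g) by exact: integrable_bounded gK.
have ic : nu.-integrable setT (EFin \o (fun=> K)).
  exact: finite_measure_integrable_cst.
have shift : \int[mu]_x (w x * (g (X x) + K)) = c * \int[nu]_y (g y + K).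
  have mgK : measurable_fun setT (fun y => g y + K) by exact: measurable_funD.
  have gK0 y : 0 <= g y + K.
    by rewrite -lerBlDr sub0r; have := gK y; rewrite ler_norml => /andP[].
  rewrite /Rintegral (ge0_integral_weighted_law mw w0 mX ewX mgK gK0) fineM//.
  by apply: integrable_fin_num => //; exact: integrableD ig ic.
have nuT : fine (nu setT) = 1 by rewrite probability_setT.
move: shift; rewrite RintegralD// mulrDr Rintegral_cst// nuT mulr1.
under eq_Rintegral do rewrite mulrDr.
rewrite RintegralD//; last first.
  by have := integrableZr measurableT K (iw _ measurableT); apply: eq_integrable.
by rewrite RintegralZr ?wXT// => /addIr.
Qed.

End ge0_Rintegral_weighted_law.

Section weighted_law_bounded.
Context d (T : measurableType d) d' (T' : measurableType d') (R : realType).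
Variables (P : probability T R) (nu : probability T' R) (X : T -> T').
Hypothesis mX : measurable_fun setT X.

Let mXB B : measurable B -> measurable (X @^-1` B).
Proof. by move=> mB; rewrite -[X in measurable X]setTI; exact: mX. Qed.

(** The same shift, now on the weight: [w + M] and the constant weight [M] are both nonnegative and
    satisfy the hypothesis with constants [c + M] and [M], the latter because [X] has law [nu].
    Subtracting gives the signed case. *)
Lemma Rintegral_weighted_law (w : T -> R) (c : R) (g : T' -> R) (M K : R) :
  (forall B, measurable B -> P (X @^-1` B) = nu B) ->
  measurable_fun setT w -> (forall x, `|w x| <= M) ->
  (forall B, measurable B ->
    \int[P]_(x in X @^-1` B) w x = c * fine (nu B)) ->
  measurable_fun setT g -> (forall y, `|g y| <= K) ->
  \int[P]_x (w x * g (X x)) = c * \int[nu]_y g y.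
Proof.
move=> PX mw wM wX mg gK.
have wM' x : - M <= w x <= M by rewrite -ler_norml.
have mgX : measurable_fun setT (g \o X) by exact: measurableT_comp.
have iw A : measurable A -> P.-integrable A (EFin \o w).
  by move=> mA; exact: integrable_bounded wM.
have iwg : P.-integrable setT (EFin \o (fun x => w x * g (X x))).
  apply: (@integrable_bounded _ _ _ _ _ _ (M * K)) => //.
    exact: measurable_funM.
  by move=> x; rewrite normrM ler_pM.
have igX : P.-integrable setT (EFin \o (fun x => M * g (X x))).
  apply: (@integrable_bounded _ _ _ _ _ _ (`|M| * K)) => //.
    exact: measurable_funM.
  by move=> x; rewrite normrM ler_pM.
have cst_law B : measurable B -> \int[P]_(x in X @^-1` B) M = M * fine (nu B).
  move=> mB; rewrite Rintegral_cst; last exact: mXB.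
  by congr (_ * fine _); exact: PX.
have hM : \int[P]_x (M * g (X x)) = M * \int[nu]_y g y.
  have M0 : 0 <= M by exact: le_trans (normr_ge0 _) (wM point).
  apply: (ge0_Rintegral_weighted_law (K := K)) => //.
  exact: finite_measure_integrable_cst.
have : \int[P]_x ((w x + M) * g (X x)) = (c + M) * \int[nu]_y g y.
  apply: (ge0_Rintegral_weighted_law (K := K)) => //.
  - have := integrableD measurableT (iw _ measurableT)
      (finite_measure_integrable_cst P M measurableT).
    exact: eq_integrable.
  - by move=> x; have /andP[] := wM' x; lra.
  - move=> B mB; rewrite RintegralD ?wX ?cst_law ?mulrDl//; first exact: mXB.
      exact/iw/mXB.
    apply: (integrableS measurableT) => //; first exact: mXB.
    exact: finite_measure_integrable_cst.
under eq_Rintegral do rewrite mulrDl.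
by rewrite RintegralD// hM mulrDl => /addIr.
Qed.

End weighted_law_bounded.

(** * One-dimensional marginals of a standard normal vector *)

Section standard_normal_vector.
Context d (T : measurableType d) (R : realType) (P : probability T R).
Variables (N : nat) (Xi : T -> 'cV[R]_N).
Hypothesis hXi : standard_normal_vector P Xi.
Local Notation nu := (@normal_prob R 0 1).
Local Notation mu := (@lebesgue_measure R).

(** Instance of the weighted law with [X = id], [c = 1] and the density as weight on Lebesgue
    measure. *)
Lemma Rintegral_normal_prob01 (g : R -> R) (K : R) :
  measurable_fun setT g -> (forall y, `|g y| <= K) ->
  \int[nu]_y g y = \int[mu]_y (g y * normal_pdf 0 1 y).
Proof.
move=> mg gK; under [RHS]eq_Rintegral do rewrite mulrC.
rewrite (@ge0_Rintegral_weighted_law _ _ _ _ _ mu nu id _ 1 g K) ?mul1r//.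
- exact: integrable_normal_pdf.
- by move=> y; exact: normal_pdf_ge0.
- by move=> B mB; rewrite mul1r.
Qed.

Lemma Rintegral_cos_normal_prob01 (l th : R) :
  \int[nu]_y cos (l * y + th) = cos th * expR (- l ^+ 2 / 2).
Proof.
rewrite (@Rintegral_normal_prob01 _ 1) ?char_normal_pdf01//.
- exact: measurable_comp_affine (@continuous_cos R).
- by move=> y; exact: cos_max.
Qed.

Lemma standard_normal_vector_law (i : 'I_N) (B : set R) :
  measurable B -> P [set w | B (Xi w i ord0)] = nu B.
Proof.
move=> mB; have [_] := hXi.
(* A rectangle whose only constrained side is the one of index [i]. *)
move=> /(_ (fun k => if k == i then B else setT)) h.
transitivity (P [set w | forall k, (if k == i then B else setT) (Xi w k ord0)]).
  congr (P _); apply/seteqP; split => w /=.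
    by move=> Bw k; case: eqP => // ->.
  by move=> /(_ i); rewrite eqxx.
rewrite h; last by move=> k; case: ifP.
rewrite (bigD1 i)//= eqxx big1 ?mule1// => k /negbTE ->.
exact: probability_setT.
Qed.

End standard_normal_vector.

(** * The characteristic function of a standard normal vector *)

Section standard_normal_char.
Context d (T : measurableType d) (R : realType) (P : probability T R).
Variables (N : nat) (Xi : T -> 'cV[R]_N).
Hypothesis hXi : standard_normal_vector P Xi.
Local Notation nu := (@normal_prob R 0 1).
Variable t : 'cV[R]_N.

(** Set-up for an induction on [m]: coordinates below [m] enter through the cosine of [S m], the
    remaining ones through the rectangle [E B]. *)
Let S m w := \sum_(k < N | (k < m)%N) t k ord0 * Xi w k ord0.
Let E (B : 'I_N -> set R) := [set w | forall k, B k (Xi w k ord0)].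

Let mXi k : measurable_fun setT (fun w => Xi w k ord0).
Proof. by have [] := hXi. Qed.

Let mE B : (forall k, measurable (B k)) -> measurable (E B).
Proof.
move=> mB.
have -> : E B = \bigcap_(k in [set: 'I_N]) ((fun w => Xi w k ord0) @^-1` (B k)).
  by apply/seteqP; split => w /= h k; [move=> _; exact: h|exact: h].
apply: fin_bigcap_measurable => // k _.
by rewrite -[X in measurable X]setTI; exact: mXi.
Qed.

Let mcosS m th : measurable_fun setT (fun w => cos (th + S m w)).
Proof.
apply: measurableT_comp; first exact: (continuous_measurable_fun (@continuous_cos R)).
apply: measurable_funD => //.
pose h (k : 'I_N) w := if (k < m)%N then t k ord0 * Xi w k ord0 else 0.
have -> : S m = (fun w => \sum_(k < N) h k w).
  by apply/funext => w; rewrite /S big_mkcond.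
apply: (@measurable_sum _ _ _ _ _ _ h) => k; rewrite /h; case: (k < m)%N => //.
exact: measurable_funM.
Qed.

(* [B k = setT] for the first [m] coordinates, so that the integrand is
   independent of the indicator of the domain. *)
Lemma Rintegral_cos_partial_sum m (B : 'I_N -> set R) th :
  (m <= N)%N -> (forall k, measurable (B k)) ->
  (forall k : 'I_N, (k < m)%N -> B k = setT) ->
  \int[P]_(w in E B) cos (th + S m w) =
  cos th * expR (- (\sum_(k < N | (k < m)%N) t k ord0 ^+ 2) / 2) *
  \prod_k fine (nu (B k)).
Proof.
(* [B] and [th] stay general: the inductive step constrains coordinate [m] to an arbitrary set and
   also uses the phase [th + pi / 2]. For [m = 0] the claim is the law of [Xi] on rectangles. *)
elim: m B th => [|m IH] B th mN mB BT.
  rewrite [X in - X]big_pred0// oppr0 mul0r expR0 mulr1.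
  under eq_Rintegral do rewrite /S big_pred0// addr0.
  rewrite Rintegral_cst; last exact: mE.
  congr (_ * _); have [_ h] := hXi.
  transitivity (fine (\prod_(k < N) nu (B k))%E); first by congr fine; exact: h.
  rewrite -[RHS]/(fine (\prod_k fine (nu (B k)))%:E).
  rewrite -prodEFin; congr fine; apply: eq_bigr => k _.
  by rewrite fineK//; exact: (fin_num_measure nu _ (mB k)).
pose i := Ordinal mN.
have SE w : S m.+1 w = t i ord0 * Xi w i ord0 + S m w.
  rewrite /S (bigD1 i) ?ltnSn//=; congr (_ + _); apply: eq_bigl => k.
  by rewrite ltnS [RHS]ltn_neqAle andbC.
have tE : \sum_(k < N | (k < m.+1)%N) t k ord0 ^+ 2 =
    t i ord0 ^+ 2 + \sum_(k < N | (k < m)%N) t k ord0 ^+ 2.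
  rewrite (bigD1 i) ?ltnSn//=; congr (_ + _); apply: eq_bigl => k.
  by rewrite ltnS [RHS]ltn_neqAle andbC.
(* The factor of the integrand that does not involve the coordinate [i]. *)
pose W u w := \1_(E B) w * cos (u + S m w).
pose c u := cos u * expR (- (\sum_(k < N | (k < m)%N) t k ord0 ^+ 2) / 2) *
  \prod_k fine (nu (B k)).
have mW u : measurable_fun setT (W u).
  by apply: measurable_funM => //; apply: measurable_indic; exact: mE.
have W1 u w : `|W u w| <= 1.
  rewrite normrM -[leRHS]mulr1 ler_pM ?cos_max// indicE.
  by case: (_ \in _); rewrite ?normr1 ?normr0.
(* Restricting coordinate [i] to [A] amounts to replacing the side [B i = setT] by [A]. The
   induction hypothesis for this new rectangle shows that [W u] weights the law of coordinate [i] by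
   the constant [c u]. *)
have lawW u (A : set R) : measurable A ->
    \int[P]_(w in (fun w => Xi w i ord0) @^-1` A) W u w = c u * fine (nu A).
  move=> mA; pose B' k := if k == i then A else B k.
  have mB' k : measurable (B' k) by rewrite /B'; case: ifP.
  transitivity (\int[P]_(w in E B') cos (u + S m w)).
    rewrite Rintegral_mkcond [RHS]Rintegral_mkcond.
    apply: eq_Rintegral => w _; rewrite /patch /W indicE.
    have -> : (w \in E B') = (w \in (fun w => Xi w i ord0) @^-1` A) && (w \in E B).
      apply/idP/andP; rewrite !inE /= /B'.
        move=> h; split; first by have := h i; rewrite eqxx.
        by move=> k; have := h k; case: eqP => // -> _; rewrite BT.
      by move=> [hA hB] k; case: eqP => // ->.
    by case: ifP => //= _; case: ifP => _; rewrite ?mul1r ?mul0r.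
  rewrite IH//; last 2 first.
  - exact: ltnW.
  - move=> k km; rewrite /B'; case: eqP => [ki|_]; first by rewrite ki ltnn in km.
    by rewrite BT// ltnS ltnW.
  rewrite /c -!mulrA; congr (_ * (_ * _)).
  rewrite (bigD1 i)//= [in RHS](bigD1 i)//= /B' eqxx BT; last exact: ltnSn.
  rewrite [X in _ = fine X * _ * _]probability_setT mul1r mulrC; congr (_ * _).
  by apply: eq_bigr => k /negbTE ->.
have law A : measurable A -> P ((fun w => Xi w i ord0) @^-1` A) = nu A.
  exact: standard_normal_vector_law.
have cosE th' u : \int[P]_w (W u w * cos (t i ord0 * Xi w i ord0 + th')) =
    c u * (cos th' * expR (- t i ord0 ^+ 2 / 2)).
  rewrite -Rintegral_cos_normal_prob01.
  apply: (@Rintegral_weighted_law _ _ _ _ _ P nu _ (mXi i) (W u) _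
    (fun y => cos (t i ord0 * y + th')) 1 1) => //; last first.
  - by move=> y; exact: cos_max.
  - exact: measurable_comp_affine (@continuous_cos R).
  - exact: lawW.
have iW u th' : P.-integrable setT
    (EFin \o (fun w => W u w * cos (t i ord0 * Xi w i ord0 + th'))).
  apply: (@integrable_bounded _ _ _ _ _ _ 1) => //.
    apply: measurable_funM => //.
    apply: (@measurableT_comp _ _ _ _ _ _ (fun y => cos (t i ord0 * y + th'))) => //.
    exact: measurable_comp_affine (@continuous_cos R).
  by move=> w; rewrite normrM -[leRHS]mulr1 ler_pM ?cos_max.
(* cos (x + y) = cos x cos y + cos (x + pi / 2) cos (y - pi / 2) *)
transitivity (\int[P]_w (W th w * cos (t i ord0 * Xi w i ord0 + 0) +
    W (th + pi / 2) w * cos (t i ord0 * Xi w i ord0 + - (pi / 2)))).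
  rewrite Rintegral_mkcond; apply: eq_Rintegral => w _.
  rewrite /patch /W indicE SE; case: (w \in E B); last by rewrite !mul0r addr0.
  rewrite !mul1r addr0 cosB cos_pihalf sin_pihalf mulr0 add0r mulr1.
  rewrite [th + _ + _]addrAC cosDpihalf [th + _]addrCA cosD.
  ring.
(* The second summand carries the factor [cos (- (pi / 2)) = 0], so only the first one survives. *)
rewrite RintegralD// !cosE cosN cos_pihalf mul0r mulr0 addr0 cos0 mul1r tE.
rewrite opprD mulrDl expRD /c; ring.
Qed.

Lemma Rintegral_cos_dotp (th : R) :
  \int[P]_w cos (th + dotp t (Xi w)) = cos th * expR (- dotp t t / 2).
Proof.
have := @Rintegral_cos_partial_sum N (fun=> setT) th (leqnn N)
  (fun=> measurableT) (fun _ _ => erefl).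
have -> : E (fun=> setT) = setT by apply/seteqP; split.
rewrite [X in _ * X](_ : _ = 1) ?mulr1; last first.
  by apply: big1 => k _; rewrite [X in fine X]probability_setT.
have -> : \sum_(k < N | (k < N)%N) t k ord0 ^+ 2 = dotp t t.
  by apply: eq_big => k; [rewrite ltn_ord|rewrite expr2].
move=> <-; apply: eq_Rintegral => w _; congr (cos (_ + _)).
by apply: eq_bigl => k; rewrite ltn_ord.
Qed.

Lemma measurable_dotp : measurable_fun setT (fun w => dotp t (Xi w)).
Proof.
pose h (k : 'I_N) w := t k ord0 * Xi w k ord0.
by apply: (@measurable_sum _ _ _ _ _ _ h) => k; exact: measurable_funM.
Qed.

End standard_normal_char.

(** * Differentiation under the integral over the unit interval *)

Section unit_interval.
Variable R : realType.
Local Notation mu := (@lebesgue_measure R).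
Local Notation I := (`]0, 1]%classic : set R).

Lemma cos_lipschitz (x y : R) : `|cos x - cos y| <= `|x - y|.
Proof.
wlog xy : x y / x <= y.
  by move=> h; have [/h//|/ltW/h] := leP x y; rewrite distrC (distrC y).
have cc : {within `[x, y], continuous (@cos R)}.
  by apply: continuous_subspaceT; exact: continuous_cos.
have [c _ E] := @MVT_segment R cos (fun x => - sin x) x y xy
  (fun z _ => is_derive_cos z) cc.
by rewrite distrC E (distrC x) normrM normrN ler_piMl// sin_max.
Qed.

Lemma measurable_inv01 : measurable_fun I (fun s : R => s^-1).
Proof.
have m : measurable_fun (`]0, +oo[%classic : set R) (@GRing.inv R).
  apply: open_continuous_measurable_fun => // s.
  rewrite inE /= in_itv /= andbT => s0.
  by apply: inv_continuous; rewrite gt_eqF.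
by apply: measurable_funS m => //; exact: subset_itvl.
Qed.

Lemma measurable_sqrt D : measurable_fun D (@Num.sqrt R).
Proof.
by apply: measurable_funTS; apply: continuous_measurable_fun; exact: sqrt_continuous.
Qed.

Let measurable_invsqrt : measurable_fun I (fun s : R => (Num.sqrt s)^-1).
Proof.
have -> : (fun s : R => (Num.sqrt s)^-1) = Num.sqrt \o (fun s : R => s^-1).
  apply/funext => s /=; have [s0|s0] := leP 0 s; first by rewrite sqrtrV.
  (* For negative [s] both square roots take the default value 0, and [0^-1 = 0]. *)
  by rewrite !ltr0_sqrtr ?invr_lt0// invr0.
by apply: measurableT_comp; [exact: measurable_sqrt|exact: measurable_inv01].
Qed.

Lemma integrable_invsqrt : mu.-integrable I (fun s => ((Num.sqrt s)^-1)%:E).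
Proof.
apply/integrableP; split; first exact/measurable_EFinP.
under eq_integral do rewrite /= ger0_norm ?invr_ge0 ?sqrtr_ge0//.
(* Monotone convergence along (s + 1 / (n + 1))^(-1/2), which is continuous on
   [0, 1]. *)
pose e n : R := n.+1%:R^-1.
have e0 n : 0 < e n by rewrite invr_gt0.
have e1 n : e n <= 1 by rewrite invf_le1// ler1n.
pose f n (s : R) := (Num.sqrt (s + e n))^-1.
pose F n (s : R) := 2 * Num.sqrt (s + e n).
have dF n (s : R) : 0 <= s -> is_derive s 1 (F n) (f n s).
  move=> s0; have se0 : 0 < s + e n by rewrite ltr_wpDl.
  have h : is_derive s (1 : R) (fun s : R => s + e n) 1.
    by apply: is_derive_eq; rewrite addr0.
  have h2 := @is_derive1_comp R (@Num.sqrt R) (fun s : R => s + e n) s _ _ (is_derive1_sqrt se0) h.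
  apply: (@is_derive_eq _ _ _ _ _ _ _ _ (is_deriveZ 2 h2)).
  by rewrite mulr1 /GRing.scale /= invfM mulrA divff ?mul1r.
have cf n (s : R) : 0 <= s -> {for s, continuous (f n)}.
  move=> s0; apply: cvgV; first by rewrite sqrtr_eq0 -ltNge ltr_wpDl.
  apply: continuous_comp; last exact: sqrt_continuous.
  by apply: cvgD; [exact: cvg_id|exact: cvg_cst].
have cF n (s : R) : 0 <= s -> {for s, continuous (F n)}.
  by move=> s0; apply/differentiable_continuous/derivable1_diffP; have [] := dF n s s0.
have cfI n : {within `[0, 1], continuous (f n)}.
  by apply: continuous_in_subspaceT => s; rewrite inE /= in_itv /= => /andP[s0 _]; exact: cf.
have mf n : measurable_fun I (EFin \o f n).
  have m : measurable_fun (`[0, 1]%classic : set R) (f n).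
    by apply: subspace_continuous_measurable_fun => //; exact: cfI.
  apply/measurable_EFinP; apply: measurable_funS m => //.
  exact: subset_itv_oc_cc.
(* The integral is [F n 1 - F n 0], at most [2 * Num.sqrt (1 + e n)]; since [e n <= 1], the root is
   at most 2. Any bound uniform in [n] would do. *)
have If n : (\int[mu]_(s in I) (f n s)%:E <= 4%:E)%E.
  rewrite integral_itv_obnd_cbnd; last exact: mf.
  rewrite (@continuous_FTC2 _ (f n) (F n)) //; first last.
  - by move=> s; rewrite in_itv /= derive1E => /andP[/ltW s0 _]; have [] := dF n s s0.
  - split.
    + by move=> s; rewrite in_itv /= => /andP[/ltW s0 _]; have [] := dF n s s0.
    + by apply: cvg_at_right_filter; apply: cF.
    + by apply: cvg_at_left_filter; apply: cF.
  rewrite -EFinB lee_fin /F.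
  have : Num.sqrt (1 + e n) <= 2.
    rewrite -[leRHS]ger0_norm// -sqrtr_sqr ler_sqrt ?sqr_ge0//.
    by have := e1 n; nra.
  by have := sqrtr_ge0 (0 + e n); lra.
have [fnd fE] : (forall s, I s -> {homo (fun n => (f n s)%:E) : m n / (m <= n)%N >-> (m <= n)%E}) /\
    (forall s, I s -> (fun n => (f n s)%:E) @ \oo --> ((Num.sqrt s)^-1)%:E).
  split=> s; rewrite /= in_itv /= => /andP[s0 _].
    move=> m n mn; rewrite lee_fin lef_pV2 ?posrE ?sqrtr_gt0 ?addr_gt0//.
    by apply: ler_wsqrtr; rewrite lerD2l /e lef_pV2 ?posrE ?ltr0Sn// ler_nat.
  apply: cvg_EFin; first exact: nearW.
  apply: cvgV; first by rewrite sqrtr_eq0 -ltNge.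
  apply: continuous_cvg; first exact: sqrt_continuous.
  rewrite -[X in _ --> X]addr0; apply: cvgD; first exact: cvg_cst.
  exact: cvg_harmonic.
have := @cvg_monotone_convergence _ _ _ mu I (measurable_itv _)
  (fun n s => (f n s)%:E) mf _ fnd.
have -> : (\int[mu]_(s in I) limn (fun n => (f n s)%:E) =
    \int[mu]_(s in I) (Num.sqrt s)^-1%:E)%E.
  by apply: eq_integral => s /set_mem sI; apply/cvg_lim => //; exact: fE.
move=> cvgI; apply: (@le_lt_trans _ _ 4%:E); last exact: ltry.
rewrite -(cvg_lim _ (cvgI _))//; last first.
  by move=> n s _; rewrite lee_fin invr_ge0 sqrtr_ge0.
apply: lime_le; last by apply: nearW => n; exact: If.
apply/cvg_ex; eexists; apply: cvgI => n s _.
by rewrite lee_fin invr_ge0 sqrtr_ge0.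
Qed.

(** * The integrand of g_th and its derivatives in u *)

Variables (a th : R).
Hypothesis a0 : 0 <= a.

(** Here [a] stands for |t|^2 and [u] for <t, x>; [stein_integrand1] and [stein_integrand2] are the
    successive derivatives in [u] for [s] in []0, 1]]. *)
Definition stein_integrand (u s : R) := 1 / (2 * s) *
  (expR (- a / 2) * cos th - expR (- ((1 - s) * a) / 2) * cos (Num.sqrt s * u + th)).

Definition stein_integrand1 (u s : R) :=
  1 / 2 * (Num.sqrt s)^-1 * (expR (- ((1 - s) * a) / 2) * sin (Num.sqrt s * u + th)).

Definition stein_integrand2 (u s : R) :=
  1 / 2 * (expR (- ((1 - s) * a) / 2) * cos (Num.sqrt s * u + th)).

Let damp s : I s -> 0 <= expR (- ((1 - s) * a) / 2) <= 1.
Proof.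
rewrite /= in_itv /= => /andP[_ s1]; rewrite expR_ge0 /= -[leRHS]expR0 ler_expR.
by rewrite mulNr oppr_le0 divr_ge0// mulr_ge0// subr_ge0.
Qed.

Let mdamp D : measurable_fun D (fun s : R => expR (- ((1 - s) * a) / 2)).
Proof.
apply: measurableT_comp => //; apply: measurable_funM => //.
apply: measurableT_comp => //; apply: measurable_funM => //.
exact: measurable_funB.
Qed.

Let mphase D f u : continuous (f : R -> R) ->
  measurable_fun D (fun s : R => f (Num.sqrt s * u + th)).
Proof.
move=> cf; apply: measurableT_comp; first exact: continuous_measurable_fun.
by apply: measurable_funD => //; apply: measurable_funM => //; exact: measurable_sqrt.
Qed.

(** Insert [D * cos th] between the two terms. The damping factors differ by O(s), the cosines by
    O(sqrt s), and [s <= Num.sqrt s] on the unit interval, so the factor 1/(2s) leaves a singularity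
    of order s^(-1/2). *)
Lemma stein_integrand_le u s : I s ->
  `|stein_integrand u s| <= (a / 4 + `|u| / 2) * (Num.sqrt s)^-1.
Proof.
move=> sI; have /andP[D0 D1] := damp sI.
move: sI; rewrite /= in_itv /= => /andP[s0 s1].
rewrite /stein_integrand; set D := expR (- ((1 - s) * a) / 2) in D0 D1 *.
have rs0 : 0 < Num.sqrt s by rewrite sqrtr_gt0.
have rsE : Num.sqrt s ^+ 2 = s by rewrite sqr_sqrtr// ltW.
have rs1 : Num.sqrt s <= 1 by rewrite -sqrtr1 ler_sqrt.
(* With this factorization the first difference is governed by 1 - exp(-s a / 2), which is at most s
   a / 2. *)
have E0 : expR (- a / 2) = D * expR (- (s * a / 2)).
  by rewrite -expRD; congr expR; field.
have E1 : 1 - s * a / 2 <= expR (- (s * a / 2)) by exact: expR_ge1Dx.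
have E2 : expR (- (s * a / 2)) <= 1.
  by rewrite -[leRHS]expR0 ler_expR oppr_le0 divr_ge0// mulr_ge0// ltW.
have h1 : `|expR (- a / 2) * cos th - D * cos th| <= s * a / 2.
  rewrite -mulrBl normrM E0 -[X in _ - X]mulr1 -mulrBr normrM.
  rewrite (ger0_norm D0) (ler0_norm (x := expR _ - 1)) ?subr_le0// opprB.
  apply: (@le_trans _ _ (1 - expR (- (s * a / 2)))); last by lra.
  have X0 : 0 <= 1 - expR (- (s * a / 2)) by rewrite subr_ge0.
  by rewrite -[leRHS]mulr1 ler_pM ?cos_max ?mulr_ge0// ler_piMl.
have h2 : `|D * cos th - D * cos (Num.sqrt s * u + th)| <= Num.sqrt s * `|u|.
  rewrite -mulrBr normrM (ger0_norm D0).
  have := cos_lipschitz th (Num.sqrt s * u + th).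
  rewrite opprD addrCA subrr addr0 normrN normrM (ger0_norm (ltW rs0)).
  by apply: le_trans; rewrite ler_piMl.
have h3 := ler_distD (D * cos th) (expR (- a / 2) * cos th) (D * cos (Num.sqrt s * u + th)).
rewrite normrM (ger0_norm (x := 1 / (2 * s))); last by rewrite divr_ge0// mulr_ge0// ltW.
apply: (@le_trans _ _ (1 / (2 * s) * (Num.sqrt s * (a / 2 + `|u|)))).
  rewrite ler_wpM2l//; first by rewrite divr_ge0// mulr_ge0// ltW.
  rewrite (le_trans h3)// mulrDr (le_trans (lerD h1 h2))// lerD2r.
  rewrite -mulrA ler_wpM2r//; first by rewrite divr_ge0.
  by rewrite -[leLHS]rsE expr2 ler_piMl// ltW.
rewrite le_eqVlt; apply/orP; left; apply/eqP.
by rewrite -[in 1 / (2 * s)]rsE; field; rewrite gt_eqF.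
Qed.

Lemma integrable_stein_integrand u :
  mu.-integrable I (EFin \o stein_integrand u).
Proof.
have ib := @integrableZl _ _ _ mu I (measurable_itv _) (a / 4 + `|u| / 2) _ integrable_invsqrt.
apply: le_integrable ib => //.
- apply/measurable_EFinP; apply: measurable_funM.
  + have -> : (fun s : R => 1 / (2 * s)) = (fun s : R => 2^-1 * s^-1).
      by apply/funext => s; rewrite mul1r invfM.
    by apply: measurable_funM => //; exact: measurable_inv01.
  + apply: measurable_funB => //; apply: measurable_funM; first exact: mdamp.
    by apply: mphase; exact: continuous_cos.
- move=> s sI /=; rewrite lee_fin (le_trans (stein_integrand_le u sI))//.
  exact: ler_norm.
Qed.

Lemma stein_integrand1_le u s : I s ->
  `|stein_integrand1 u s| <= 1 / 2 * (Num.sqrt s)^-1.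
Proof.
move=> sI; have /andP[D0 D1] := damp sI.
rewrite /stein_integrand1 normrM ger0_norm ?mulr_ge0 ?invr_ge0 ?sqrtr_ge0//.
rewrite ler_piMr ?mulr_ge0 ?invr_ge0 ?sqrtr_ge0// normrM ger0_norm//.
by rewrite -[leRHS]mulr1 ler_pM ?sin_max.
Qed.

Lemma integrable_stein_integrand1 u :
  mu.-integrable I (EFin \o stein_integrand1 u).
Proof.
have ib := @integrableZl _ _ _ mu I (measurable_itv _) (1 / 2) _ integrable_invsqrt.
apply: le_integrable ib => //.
- apply/measurable_EFinP; apply: measurable_funM.
    by apply: measurable_funM.
  apply: measurable_funM; first exact: mdamp.
  by apply: mphase; exact: continuous_sin.
- move=> s sI /=; rewrite lee_fin (le_trans (stein_integrand1_le u sI))//.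
  exact: ler_norm.
Qed.

Lemma stein_integrand2_le u s : I s -> `|stein_integrand2 u s| <= 1 / 2.
Proof.
move=> sI; have /andP[D0 D1] := damp sI.
rewrite /stein_integrand2 normrM ger0_norm// ler_piMr// normrM ger0_norm//.
by rewrite -[leRHS]mulr1 ler_pM ?cos_max.
Qed.

Let integrable_cst01 (k : R) : mu.-integrable I (EFin \o (fun=> k)).
Proof.
apply: measurable_bounded_integrable => //.
  by rewrite /= lebesgue_measure_itv /= lte01 -EFinB ltry.
exists `|k|; split; first exact: num_real.
by move=> x kx y _; exact: ltW.
Qed.

Lemma integrable_stein_integrand2 u :
  mu.-integrable I (EFin \o stein_integrand2 u).
Proof.
apply: le_integrable (integrable_cst01 (1 / 2)) => //.
- apply/measurable_EFinP; apply: measurable_funM => //.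
  apply: measurable_funM; first exact: mdamp.
  by apply: mphase; exact: continuous_cos.
- move=> s sI /=; rewrite lee_fin (le_trans (stein_integrand2_le u sI))//.
  exact: ler_norm.
Qed.

(** The bound on the integrand depends on [u] and gives integrability for each [u]; the bound on its
    derivative is uniform in [u] and serves as majorant. *)
Lemma is_derive_stein_integral (u : R) :
  is_derive u 1 (fun u => \int[mu]_(s in I) stein_integrand u s)
    (\int[mu]_(s in I) stein_integrand1 u s).
Proof.
apply: (@is_derive_Rintegral _ _ _ mu I _ _ (fun s => 1 / 2 * (Num.sqrt s)^-1)) => //.
- exact: integrable_stein_integrand.
- move=> {}u s; rewrite /= in_itv /= => /andP[s0 _].
  have h := is_derive_cos_affine (Num.sqrt s) th u.
  have -> : stein_integrand ^~ s = (fun u => 1 / (2 * s) * (expR (- a / 2) * cos th)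
      + (- (1 / (2 * s) * expR (- ((1 - s) * a) / 2))) * cos (u * Num.sqrt s + th)).
    by apply/funext => v; rewrite /stein_integrand [v * _]mulrC; ring.
  have h2 := is_deriveD (is_derive_cst (1 / (2 * s) * (expR (- a / 2) * cos th) : R) u 1)
    (is_deriveZ (- (1 / (2 * s) * expR (- ((1 - s) * a) / 2))) h).
  apply: (@is_derive_eq _ _ _ _ _ _ _ _ h2).
  rewrite /GRing.scale /= add0r /stein_integrand1 [u * _]mulrC.
  (* The chain rule produces a factor [Num.sqrt s], which cancels half of the singularity 1/(2s). *)
  have rsE : s = Num.sqrt s ^+ 2 by rewrite sqr_sqrtr// ltW.
  rewrite [in 1 / (2 * s)]rsE; field.
  by rewrite sqrtr_eq0 -ltNge.
- have := @integrableZl _ _ _ mu I (measurable_itv _) (1 / 2) _ integrable_invsqrt.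
  exact: eq_integrable.
- by move=> {}u s; exact: stein_integrand1_le.
Qed.

Lemma is_derive_stein_integral1 (u : R) :
  is_derive u 1 (fun u => \int[mu]_(s in I) stein_integrand1 u s)
    (\int[mu]_(s in I) stein_integrand2 u s).
Proof.
apply: (@is_derive_Rintegral _ _ _ mu I _ _ (fun s => 1 / 2)) => //.
- exact: integrable_stein_integrand1.
- move=> {}u s; rewrite /= in_itv /= => /andP[s0 _].
  have h := is_derive_sin_affine (Num.sqrt s) th u.
  have -> : stein_integrand1 ^~ s = (fun u =>
      (1 / 2 * (Num.sqrt s)^-1 * expR (- ((1 - s) * a) / 2)) * sin (u * Num.sqrt s + th)).
    by apply/funext => v; rewrite /stein_integrand1 [v * _]mulrC; ring.
  have h2 := is_deriveZ (1 / 2 * (Num.sqrt s)^-1 * expR (- ((1 - s) * a) / 2)) h.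
  apply: (@is_derive_eq _ _ _ _ _ _ _ _ h2).
  rewrite /GRing.scale /= /stein_integrand2 [u * _]mulrC; field.
  by rewrite sqrtr_eq0 -ltNge.
- by move=> {}u s; exact: stein_integrand2_le.
Qed.

End unit_interval.

(** * The Hessian of the Stein solution *)

Section complex_formulas.
Variable R : realType.

Lemma cexpD (z w : R[i]) : cexp (z + w) = cexp z * cexp w.
Proof.
case: z => a b; case: w => c d; rewrite /cexp /=.
apply/eqP; rewrite eq_complex /= expRD cosD sinD; apply/andP; split; apply/eqP; ring.
Qed.

Lemma cexp_phase (v w : R) : cexp (- ('i%C * v%:C) - w%:C) =
  (expR (- w) * cos v) +i* (expR (- w) * cos (v + pi / 2)).
Proof.
rewrite /cexp cosDpihalf -sinN.
have -> : - ('i%C * v%:C) - w%:C = (- w) +i* (- v).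
  by apply/eqP; rewrite eq_complex /=; apply/andP; split; apply/eqP; ring.
rewrite /= cosN; apply/eqP; rewrite eq_complex /=; apply/andP; split; apply/eqP; ring.
Qed.

Lemma e_E (N : nat) (t x : 'cV[R]_N) :
  e_ t x = cos (dotp t x) +i* cos (dotp t x + pi / 2).
Proof.
have := cexp_phase (dotp t x) 0.
by rewrite !oppr0 expR0 !mul1r /e_ addr0.
Qed.

End complex_formulas.

(** * Functions of the inner product with a fixed vector *)

Section dotp_theory.
Variables (R : realType) (N : nat).
Implicit Types (t x y : 'cV[R]_N).

Lemma dotpDr t x y : dotp t (x + y) = dotp t x + dotp t y.
Proof. by rewrite /dotp -big_split; apply: eq_bigr => k _; rewrite mxE mulrDr. Qed.

Lemma dotpZr t (c : R) x : dotp t (c *: x) = c * dotp t x.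
Proof. by rewrite /dotp mulr_sumr; apply: eq_bigr => k _; rewrite mxE mulrCA. Qed.

Lemma dotpBr t x y : dotp t (x - y) = dotp t x - dotp t y.
Proof. by rewrite dotpDr -[- y]scaleN1r dotpZr mulN1r. Qed.

Lemma dotpC t x : dotp t x = dotp x t.
Proof. by apply: eq_bigr => k _; rewrite mulrC. Qed.

Lemma dotpZl t (c : R) x : dotp (c *: t) x = c * dotp t x.
Proof. by rewrite dotpC dotpZr dotpC. Qed.

Lemma dotp_delta t (k : 'I_N) : dotp t (delta_mx k ord0) = t k ord0.
Proof.
rewrite /dotp (bigD1 k)//= mxE !eqxx mulr1 big1 ?addr0// => j /negbTE jk.
by rewrite mxE jk mulr0.
Qed.

Lemma dotp_ge0 t : 0 <= dotp t t.
Proof. by apply: sumr_ge0 => k _; rewrite -expr2 sqr_ge0. Qed.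

Lemma differentiable_dotp t x : differentiable (dotp t) x.
Proof.
have -> : dotp t = \sum_(k < N) (fun y : 'cV[R]_N => t k ord0 * y k ord0).
  by apply/funext => y; rewrite fct_sumE.
apply: differentiable_sum => k.
apply: differentiableM; first exact: differentiable_cst.
exact: differentiable_coord.
Qed.

Lemma derive_dotp t x v : 'D_v (dotp t) x = dotp t v.
Proof.
(* By linearity the difference quotient is constant for nonzero [h]. *)
apply/cvg_lim => //.
apply: cvg_near_cst; near=> h.
have h0 : h != 0 by near: h; exact: nbhs_dnbhs_neq.
by rewrite /= dotpDr dotpZr addrK /GRing.scale /= mulKf.
Unshelve. all: by end_near. Qed.

Lemma differentiable_comp_dotp (phi dphi : R -> R) t x :
  (forall u : R, is_derive u 1 phi (dphi u)) ->
  differentiable (fun y => phi (dotp t y)) x.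
Proof.
move=> dp; apply: (@differentiable_comp _ _ _ _ (dotp t) phi).
  exact: differentiable_dotp.
by apply/derivable1_diffP; have [] := dp (dotp t x).
Qed.

Lemma derive_comp_dotp (phi dphi : R -> R) t x v :
  (forall u : R, is_derive u 1 phi (dphi u)) ->
  'D_v (fun y => phi (dotp t y)) x = dphi (dotp t x) * dotp t v.
Proof.
move=> dp.
have dphi' : differentiable phi (dotp t x).
  by apply/derivable1_diffP; have [] := dp (dotp t x).
rewrite deriveE; last exact: differentiable_comp_dotp dp.
rewrite (@diff_comp _ _ _ _ (dotp t) phi)//=; last exact: differentiable_dotp.
rewrite diff1E// -deriveE ?derive_dotp; last exact: differentiable_dotp.
rewrite derive1E; have [_ ->] := dp (dotp t x).
by rewrite /GRing.scale /= mulrC.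
Qed.

(** The chain rule returns a function of the same shape, with the factor [t k ord0] in front, so two
    applications yield the entries of the Hessian. *)
Lemma partial_comp_dotp (phi dphi psi dpsi : R -> R) t (k : 'I_N) :
  (forall u : R, is_derive u 1 phi (dphi u)) ->
  (forall u : R, is_derive u 1 psi (dpsi u)) ->
  partial k (fun y => phi (dotp t y) +i* psi (dotp t y)) =
  fun y => (t k ord0 * dphi (dotp t y)) +i* (t k ord0 * dpsi (dotp t y)).
Proof.
move=> dp dq; apply/funext => y; rewrite /partial /=.
by rewrite (derive_comp_dotp _ _ _ dp) (derive_comp_dotp _ _ _ dq) dotp_delta mulrC
  [dpsi _ * _]mulrC.
Qed.

Lemma cdifferentiable_comp_dotp (phi dphi psi dpsi : R -> R) t x :
  (forall u : R, is_derive u 1 phi (dphi u)) ->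
  (forall u : R, is_derive u 1 psi (dpsi u)) ->
  cdifferentiable (fun y => phi (dotp t y) +i* psi (dotp t y)) x.
Proof.
by move=> dp dq; split; [exact: differentiable_comp_dotp dp|
  exact: differentiable_comp_dotp dq].
Qed.

End dotp_theory.

(* [s = 0] is left out: with 0^-1 = 0 the second u-derivative of the integrand
   of [stein_solution] is 0 there, not the limit as s tends to 0. *)
Lemma integral01E (R : realType) (F : R -> R[i]) (A B : R -> R) :
  (forall s, `]0, 1]%classic s -> F s = A s +i* B s) ->
  lebesgue_measure.-integrable `]0, 1]%classic (EFin \o A) ->
  lebesgue_measure.-integrable `]0, 1]%classic (EFin \o B) ->
  integral01 F =
  (\int[lebesgue_measure]_(s in `]0, 1]%classic) A s) +i*
  (\int[lebesgue_measure]_(s in `]0, 1]%classic) B s).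
Proof.
move=> FE iA iB; rewrite /integral01; congr (_ +i* _).
- rewrite -Rintegral_itv_obnd_cbnd; last first.
    by apply: eq_integrable iA => // s /set_mem sI; rewrite /= FE.
  by apply: eq_Rintegral => s /set_mem sI; rewrite FE.
- rewrite -Rintegral_itv_obnd_cbnd; last first.
    by apply: eq_integrable iB => // s /set_mem sI; rewrite /= FE.
  by apply: eq_Rintegral => s /set_mem sI; rewrite FE.
Qed.

(** * The Stein solution for the test function e_t *)

Section stein.
Context d (T : measurableType d) (R : realType) (P : probability T R).
Variables (N : nat) (Xi : T -> 'cV[R]_N).
Hypothesis hXi : standard_normal_vector P Xi.
Variable t : 'cV[R]_N.
Local Notation mu := (@lebesgue_measure R).
Local Notation I := (`]0, 1]%classic : set R).
Local Notation a := (dotp t t).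

Let g th u := \int[mu]_(s in I) stein_integrand a th u s.
Let g1 th u := \int[mu]_(s in I) stein_integrand1 a th u s.
Let g2 th u := \int[mu]_(s in I) stein_integrand2 a th u s.

Let integrable_cos (v : 'cV[R]_N) th :
  P.-integrable setT (EFin \o (fun w => cos (th + dotp v (Xi w)))).
Proof.
apply: (@integrable_bounded _ _ _ _ _ _ 1) => //; last by move=> w; exact: cos_max.
apply: measurableT_comp; first exact: (continuous_measurable_fun (@continuous_cos R)).
by apply: measurable_funD => //; exact: measurable_dotp hXi v.
Qed.

Lemma expectation_cos_dotp (x : 'cV[R]_N) (s th : R) : 0 <= s <= 1 ->
  fine ('E_P[fun w => cos (dotp t (Xi w) + th) -
    cos (dotp t (Num.sqrt s *: x + Num.sqrt (1 - s) *: Xi w) + th)]) =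
  expR (- a / 2) * cos th -
  expR (- ((1 - s) * a) / 2) * cos (Num.sqrt s * dotp t x + th).
Proof.
move=> /andP[s0 s1]; rewrite unlock -/(Rintegral P setT _).
(* Moving [Num.sqrt (1 - s)] from [Xi] onto [t] makes the cosine formula applicable to the scaled
   vector, whose squared length is [(1 - s) * a] because [s <= 1]. *)
transitivity (\int[P]_w (cos (th + dotp t (Xi w)) -
    cos (Num.sqrt s * dotp t x + th + dotp (Num.sqrt (1 - s) *: t) (Xi w)))).
  apply: eq_Rintegral => w _; rewrite dotpDr !dotpZr dotpZl.
  by congr (cos _ - cos _); ring.
rewrite RintegralB// !(Rintegral_cos_dotp hXi) dotpZl dotpZr mulrA -expr2.
by rewrite sqr_sqrtr ?subr_ge0// ![cos _ * _]mulrC.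
Qed.

Lemma stein_solutionE :
  stein_solution P Xi (e_ t) =
  (fun x => g 0 (dotp t x) +i* g (pi / 2) (dotp t x)).
Proof.
apply/funext => x; apply: integral01E; last 2 first.
- exact: integrable_stein_integrand (dotp_ge0 t) _.
- exact: integrable_stein_integrand (dotp_ge0 t) _.
move=> s; rewrite /= in_itv /= => /andP[s0 s1].
have s01 : 0 <= s <= 1 by rewrite ltW.
have -> : cexpectation P (fun w => e_ t (Xi w) -
      e_ t (Num.sqrt s *: x + Num.sqrt (1 - s) *: Xi w)) =
    (expR (- a / 2) * cos 0 -
      expR (- ((1 - s) * a) / 2) * cos (Num.sqrt s * dotp t x + 0)) +i*
    (expR (- a / 2) * cos (pi / 2) -
      expR (- ((1 - s) * a) / 2) * cos (Num.sqrt s * dotp t x + pi / 2)).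
  rewrite -!expectation_cos_dotp// /cexpectation; congr (fine _ +i* fine _).
    by congr expectation; apply/funext => w; rewrite !e_E /= !addr0.
  by congr expectation; apply/funext => w; rewrite !e_E.
rewrite /stein_integrand; apply/eqP; rewrite eq_complex /=.
by apply/andP; split; apply/eqP; ring.
Qed.

Let dg th (u : R) : is_derive u 1 (g th) (g1 th u).
Proof. exact: is_derive_stein_integral (dotp_ge0 t) _. Qed.

(** The constant [c] will be the coordinate of [t] produced by the first partial derivative. *)
Let dg1 th c (u : R) : is_derive u 1 (fun u => c * g1 th u) (c * g2 th u).
Proof.
exact: (is_deriveZ c (is_derive_stein_integral1 th (dotp_ge0 t) u)).
Qed.

Lemma partial_stein_solution (l : 'I_N) :
  partial l (stein_solution P Xi (e_ t)) =
  (fun x => (t l ord0 * g1 0 (dotp t x)) +i* (t l ord0 * g1 (pi / 2) (dotp t x))).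
Proof. by rewrite stein_solutionE (partial_comp_dotp _ _ (dg 0) (dg (pi / 2))). Qed.

Lemma twice_differentiable_stein_solution :
  twice_differentiable (stein_solution P Xi (e_ t)).
Proof.
move=> x; split.
  by rewrite stein_solutionE; exact: cdifferentiable_comp_dotp (dg 0) (dg (pi / 2)).
move=> k; rewrite partial_stein_solution.
exact: (cdifferentiable_comp_dotp _ _ (dg1 0 (t k ord0)) (dg1 (pi / 2) (t k ord0))).
Qed.

(** The factor 2 undoes the 1/2 inside [stein_integrand2], which the theorem keeps in front of the
    integral. *)
Let cexp_integrand x s :
  cexp (- ('i%C * (Num.sqrt s * dotp t x)%:C) - (1 / 2 * (1 - s) * a)%:C) =
  (2 * stein_integrand2 a 0 (dotp t x) s) +i*
  (2 * stein_integrand2 a (pi / 2) (dotp t x) s).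
Proof.
rewrite cexp_phase /stein_integrand2 addr0.
have -> : - (1 / 2 * (1 - s) * a) = - ((1 - s) * a) / 2 by field.
by congr (_ +i* _); field.
Qed.

Let integrable_integrand2 th u :
  mu.-integrable I (EFin \o (fun s => 2 * stein_integrand2 a th u s)).
Proof.
have := @integrableZl _ _ _ mu I (measurable_itv _) 2 _
  (integrable_stein_integrand2 th (dotp_ge0 t) u).
exact: eq_integrable.
Qed.

Let integral01_cexp x :
  integral01 (fun s => cexp (- ('i%C * (Num.sqrt s * dotp t x)%:C)
                 - (1 / 2 * (1 - s) * a)%:C)) =
  (2 * g2 0 (dotp t x)) +i* (2 * g2 (pi / 2) (dotp t x)).
Proof.
rewrite (integral01E (A := fun s => 2 * stein_integrand2 a 0 (dotp t x) s)
  (B := fun s => 2 * stein_integrand2 a (pi / 2) (dotp t x) s)).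
- by rewrite !(@RintegralZl _ _ _ _ _ _ 2)//;
    exact: integrable_stein_integrand2 _ (dotp_ge0 t) _.
- by move=> s _; exact: cexp_integrand.
- exact: integrable_integrand2.
- exact: integrable_integrand2.
Qed.

Lemma Hess_stein_solution (x : 'cV[R]_N) :
  Hess (stein_solution P Xi (e_ t)) x =
  (1 / 2 * integral01 (fun s =>
     cexp (- ('i%C * (Num.sqrt s * dotp t x)%:C)
           - (1 / 2 * (1 - s) * a)%:C))) *: outer t.
Proof.
apply/matrixP => k l; rewrite !mxE big_ord1 !mxE partial_stein_solution.
rewrite (partial_comp_dotp _ _ (dg1 0 (t l ord0)) (dg1 (pi / 2) (t l ord0))).
rewrite integral01_cexp.
(* As an embedded real number, 1/2 acts separately on the real and imaginary parts. *)
have -> : 1 / 2 = (1 / 2 : R)%:C by rewrite rmorphM rmorphV ?unitfE// rmorph1 rmorph_nat.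
by apply/eqP; rewrite eq_complex /=; apply/andP; split; apply/eqP; field.
Qed.

Lemma Hess_stein_solutionB (x y : 'cV[R]_N) :
  Hess (stein_solution P Xi (e_ t)) x - Hess (stein_solution P Xi (e_ t)) y =
  (1 / 2 * integral01 (fun s =>
     e_ (Num.sqrt s *: t) y * (e_ (Num.sqrt s *: t) (x - y) - 1) *
     cexp (- (1 / 2 * (1 - s) * a)%:C))) *: outer t.
Proof.
rewrite !Hess_stein_solution -scalerBl -mulrBr; congr (1 / 2 * _ *: _).
rewrite !integral01_cexp.
rewrite (integral01E
  (A := fun s => 2 * stein_integrand2 a 0 (dotp t x) s - 2 * stein_integrand2 a 0 (dotp t y) s)
  (B := fun s => 2 * stein_integrand2 a (pi / 2) (dotp t x) s -
    2 * stein_integrand2 a (pi / 2) (dotp t y) s)); first last.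
- have := @integrableB _ _ _ mu I (measurable_itv _) _ _ (integrable_integrand2 (pi / 2) (dotp t x))
    (integrable_integrand2 (pi / 2) (dotp t y)).
  exact: eq_integrable.
- have := @integrableB _ _ _ mu I (measurable_itv _) _ _ (integrable_integrand2 0 (dotp t x))
    (integrable_integrand2 0 (dotp t y)).
  exact: eq_integrable.
(* The exponents of the factors at [y] and [x - y] add up to the one at [x], so the integrand is the
   difference of those in the formulas for [x] and [y]. *)
- move=> s _; rewrite mulrBr mulr1 mulrBl /e_ -!cexpD.
  have -> : - ('i%C * (dotp (Num.sqrt s *: t) y)%:C) +
      - ('i%C * (dotp (Num.sqrt s *: t) (x - y))%:C) + - (1 / 2 * (1 - s) * a)%:C =
      - ('i%C * (Num.sqrt s * dotp t x)%:C) - (1 / 2 * (1 - s) * a)%:C.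
    rewrite !dotpZl dotpBr; apply/eqP; rewrite eq_complex /=.
    by apply/andP; split; apply/eqP; ring.
  by rewrite dotpZl !cexp_integrand.
- have i2 th u := integrable_stein_integrand2 th (dotp_ge0 t) u.
  rewrite !RintegralB//; [|exact: integrable_integrand2..].
  by rewrite !(@RintegralZl _ _ _ _ _ _ 2).
Qed.

End stein.

Theorem proposition3p5 (R : realType) (d : measure_display)
    (T : measurableType d) (P : probability T R)
    (N : nat) (hN : (1 <= N)%N) (Xi : T -> 'cV[R]_N)
    (hXi : standard_normal_vector P Xi) (t : 'cV[R]_N) :
  let f := stein_solution P Xi (e_ t) in
  [/\ twice_differentiable f,
      forall x : 'cV[R]_N,
        Hess f x =
        (1 / 2 * integral01 (fun s =>
           cexp (- ('i%C * (Num.sqrt s * dotp t x)%:C)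
                 - (1 / 2 * (1 - s) * dotp t t)%:C))) *: outer t
    & forall x y : 'cV[R]_N,
        Hess f x - Hess f y =
        (1 / 2 * integral01 (fun s =>
           e_ (Num.sqrt s *: t) y * (e_ (Num.sqrt s *: t) (x - y) - 1) *
           cexp (- (1 / 2 * (1 - s) * dotp t t)%:C))) *: outer t].
Proof.
move=> f; split.
- exact: twice_differentiable_stein_solution.
- exact: Hess_stein_solution.
- exact: Hess_stein_solutionB.
Qed.
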